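(* Let $\mathbf H$ be a connected Hopf monoid in vector species over $\Bbbk$ and let $\zeta$ be a character of $\mathbf H$. For a finite set $I$, $x\in\mathbf H[I]$ and $n\in\mathbb N$ define $$\chi_I(x)(n):=\sum_{I=S_1\sqcup\cdots\sqcup S_n}(\zeta_{S_1}\otimes\cdots\otimes\zeta_{S_n})\circ\Delta_{S_1,\dots,S_n}(x),$$ summing over all ordered decompositions of $I$ into $n$ pairwise disjoint, possibly empty, subsets. Fix a finite set $I$ and $x\in\mathbf H[I]$. (1) For each $n\in\mathbb N$ we have $\chi_I(x)(n)=\sum_{k=0}^{|I|}\chi_I^{(k)}(x)\binom nk$, where for $k=0,\dots,|I|$ $$\chi^{(k)}_I(x)=\sum_{(T_1,\dots,T_k)\vDash I}(\zeta_{T_1}\otimes\cdots\otimes\zeta_{T_k})\circ\Delta_{T_1,\dots,T_k}(x)\in\Bbbk,$$ summing over all compositions $(T_1,\dots,T_k)$ of $I$. Therefore $\chi_I(x)$ is a polynomial function of $n$ of degree at most $|I|$. (2) Let $\sigma:I\to J$ be a bijection, $x\in\mathbf H[I]$ and $y:=\mathbf H[\sigma](x)\in\mathbf H[J]$. Then $\chi_I(x)=\chi_J(y)$.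
   Context: $\Bbbk$ is a field of characteristic $0$ and $\mathbb N=\{0,1,2,\dots\}$. A vector species is a functor from finite sets with bijections to $\Bbbk$-vector spaces. A connected Hopf monoid in vector species is a vector species $\mathbf H$ with $\mathbf H[\emptyset]=\Bbbk$ together with linear maps $\mu_{S,T}:\mathbf H[S]\otimes\mathbf H[T]\to\mathbf H[I]$ and $\Delta_{S,T}:\mathbf H[I]\to\mathbf H[S]\otimes\mathbf H[T]$ for each ordered decomposition $I=S\sqcup T$ (parts may be empty), such that: both are natural with respect to bijections; (unitality) $\mu_{I,\emptyset},\mu_{\emptyset,I},\Delta_{I,\emptyset},\Delta_{\emptyset,I}$ are the canonical identifications; (associativity) for $I=R\sqcup S\sqcup T$, $\mu_{R,S\sqcup T}(\mathrm{id}\otimes\mu_{S,T})=\mu_{R\sqcup S,T}(\mu_{R,S}\otimes\mathrm{id})$ and $(\mathrm{id}\otimes\Delta_{S,T})\Delta_{R,S\sqcup T}=(\Delta_{R,S}\otimes\mathrm{id})\Delta_{R\sqcup S,T}$; (compatibility) for $S\sqcup T=I=S'\sqcup T'$ with $A=S\cap S'$, $B=S\cap T'$, $C=T\cap S'$, $D=T\cap T'$, $\Delta_{S',T'}\circ\mu_{S,T}=(\mu_{A,C}\otimes\mu_{B,D})\circ(\mathrm{id}\otimes\mathrm{swap}\otimes\mathrm{id})\circ(\Delta_{A,B}\otimes\Delta_{C,D})$. $\Delta_{S_1,\dots,S_k}:\mathbf H[I]\to\mathbf H[S_1]\otimes\cdots\otimes\mathbf H[S_k]$ denotes the iterated coproduct;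 for $k=1$ it is the identity, and for $k=0$ (only possible when $I=\emptyset$) it is the identity $\mathbf H[\emptyset]=\Bbbk\to\Bbbk$. A character $\zeta$ of $\mathbf H$ is a family of linear maps $\zeta_I:\mathbf H[I]\to\Bbbk$ which is natural ($\zeta_J(\mathbf H[\sigma](x))=\zeta_I(x)$ for bijections $\sigma:I\to J$), multiplicative ($\zeta_I(\mu_{S,T}(x\otimes y))=\zeta_S(x)\zeta_T(y)$) and unital ($\zeta_\emptyset(1)=1$). A composition $(T_1,\dots,T_k)\vDash I$ is an ordered sequence of nonempty pairwise disjoint subsets with union $I$ (for $I=\emptyset$, only the empty sequence, $k=0$). *)

(* Defs.v *)
From HB Require Import structures.
From mathcomp Require Import all_boot all_order all_algebra.
From mathcomp Require Import generic_quotient boolp.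

Set Implicit Arguments.
Unset Strict Implicit.
Unset Printing Implicit Defensive.

Import GRing.Theory.
Local Open Scope ring_scope.

(* Tensor products of arbitrary vector spaces.                                *)
(*   The elements of [tensor M N] are classes of formal finite sums           *)
(* x_1 (x) y_1 + ... + x_n (x) y_n, represented by lists of pairs, modulo the *)
(* congruence generated by commutativity of the sum and bilinearity of (x).   *)
(* Scalars are absorbed in the left factors. The universal property is given  *)
(* by [tlift], [tliftE] and [tensor_ext].                                     *)
Section TensorRelation.
Variables (k : fieldType) (M N : lmodType k).

Inductive teq : seq (M * N) -> seq (M * N) -> Prop :=
| teq_refl s : teq s s
| teq_sym s t : teq s t -> teq t s
| teq_trans s t u : teq s t -> teq t u -> teq s u
| teq_cat s s' t t' : teq s s' -> teq t t' -> teq (s ++ t) (s' ++ t')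
| teq_catC s t : teq (s ++ t) (t ++ s)
| teq_Dl x x' y : teq [:: (x + x', y)] [:: (x, y); (x', y)]
| teq_Dr x y y' : teq [:: (x, y + y')] [:: (x, y); (x, y')]
| teq_Z a x y : teq [:: (a *: x, y)] [:: (x, a *: y)]
| teq_0 y : teq [:: (0, y)] [::].

Definition teqb : rel (seq (M * N)) := fun s t => `[< teq s t >].

Fact teqb_refl : reflexive teqb.
Proof. by move=> s; apply/asboolP; apply: teq_refl. Qed.

Fact teqb_sym : symmetric teqb.
Proof.
by move=> s t; apply/idP/idP => /asboolP h; apply/asboolP; apply: teq_sym.
Qed.

Fact teqb_trans : transitive teqb.
Proof.
move=> t s u /asboolP h /asboolP h'; apply/asboolP; exact: teq_trans h h'.
Qed.

Definition teq_equiv := EquivRel teqb teqb_refl teqb_sym teqb_trans.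

Definition tensor : Type := {eq_quot teq_equiv}%qT.

HB.instance Definition _ := Choice.on tensor.

Definition tcls (s : seq (M * N)) : tensor := (\pi_({eq_quot teq_equiv}) s)%qT.
Definition trep (t : tensor) : seq (M * N) :=
  repr (t : {eq_quot teq_equiv}%qT).

Lemma trepK t : tcls (trep t) = t.
Proof. exact: reprK. Qed.

Lemma tclsP s t : reflect (teq s t) (tcls s == tcls t).
Proof.
have -> : (tcls s == tcls t) = teqb s t.
  apply/eqP/idP => [h|h].
    by have /eqmodP := h.
  by apply/eqmodP.
exact: asboolP.
Qed.

Lemma trep_cls s : teq (trep (tcls s)) s.
Proof. by apply/tclsP; rewrite trepK. Qed.

Definition tscal (a : k) (p : M * N) : M * N := (a *: p.1, p.2).

Lemma teq_map a s t : teq s t -> teq (map (tscal a) s) (map (tscal a) t).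
Proof.
elim=> [u|u v _|u v w _ h _ h'|u u' v v' _ h _ h'|u v|x x' y|x y y'|b x y|y] /=.
- exact: teq_refl.
- exact: teq_sym.
- exact: teq_trans h h'.
- by rewrite !map_cat; apply: teq_cat.
- by rewrite !map_cat; apply: teq_catC.
- by rewrite /tscal /= scalerDr; apply: teq_Dl.
- exact: teq_Dr.
- by rewrite /tscal /= scalerA mulrC -scalerA; apply: teq_Z.
- by rewrite /tscal /= scaler0; apply: teq_0.
Qed.

Definition tzero : tensor := tcls [::].
Definition tadd (t u : tensor) : tensor := tcls (trep t ++ trep u).
Definition tscale (a : k) (t : tensor) : tensor := tcls (map (tscal a) (trep t)).

Lemma tadd_cls s t : tadd (tcls s) (tcls t) = tcls (s ++ t).
Proof. by apply/eqP/tclsP; apply: teq_cat; apply: trep_cls. Qed.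

Lemma tscale_cls a s : tscale a (tcls s) = tcls (map (tscal a) s).
Proof. by apply/eqP/tclsP; apply: teq_map; apply: trep_cls. Qed.

Fact taddA : associative tadd.
Proof.
by move=> t u v; rewrite -(trepK t) -(trepK u) -(trepK v) !tadd_cls catA.
Qed.

Fact taddC : commutative tadd.
Proof.
move=> t u; rewrite -(trepK t) -(trepK u) !tadd_cls.
by apply/eqP/tclsP; apply: teq_catC.
Qed.

Fact tadd0 : left_id tzero tadd.
Proof. by move=> t; rewrite -(trepK t) tadd_cls. Qed.

Fact tscaleDl t a b : tscale (a + b) t = tadd (tscale a t) (tscale b t).
Proof.
rewrite -(trepK t) !tscale_cls tadd_cls; apply/eqP/tclsP.
elim: (trep t) => [|p s IH] /=; first exact: teq_refl.
have h : teq (tscal (a + b) p :: map (tscal (a + b)) s)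
    ([:: tscal a p; tscal b p] ++ (map (tscal a) s ++ map (tscal b) s)).
  rewrite -cat1s; apply: teq_cat IH.
  by rewrite /tscal scalerDl; apply: teq_Dl.
apply: (teq_trans h); apply: (teq_cat (teq_refl [:: tscal a p])).
rewrite -[X in teq _ X]/(_ ++ ([:: tscal b p] ++ map (tscal b) s)) catA.
exact: (teq_cat (teq_catC [:: tscal b p] _) (teq_refl _)).
Qed.

Fact tscale0 t : tscale 0 t = tzero.
Proof.
rewrite -(trepK t) tscale_cls; apply/eqP/tclsP.
elim: (trep t) => [|p s IH] /=; first exact: teq_refl.
rewrite -cat1s; apply: (@teq_cat _ [::]) IH.
by rewrite /tscal scale0r; apply: teq_0.
Qed.

Fact tscale1 : left_id 1 tscale.
Proof.
move=> t; rewrite -(trepK t) tscale_cls; congr tcls.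
by rewrite -[RHS]map_id; apply: eq_map => -[x y]; rewrite /tscal scale1r.
Qed.

Fact taddN : left_inverse tzero (tscale (-1)) tadd.
Proof. by move=> t; rewrite -[X in tadd _ X]tscale1 -tscaleDl addNr tscale0. Qed.

HB.instance Definition _ := GRing.isZmodule.Build tensor taddA taddC tadd0 taddN.

Fact tscaleA a b t : tscale a (tscale b t) = tscale (a * b) t.
Proof.
rewrite -(trepK t) !tscale_cls -map_comp; congr tcls.
by apply: eq_map => p; rewrite /tscal /= scalerA.
Qed.

Lemma tclsD s t : tcls s + tcls t = tcls (s ++ t).
Proof. exact: tadd_cls. Qed.

Fact tscaleDr : right_distributive tscale +%R.
Proof.
move=> a t u; rewrite -(trepK t) -(trepK u).
by rewrite tclsD !tscale_cls tclsD map_cat.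
Qed.

HB.instance Definition _ :=
  GRing.Zmodule_isLmodule.Build k tensor tscaleA tscale1 tscaleDr tscaleDl.

Lemma tclsZ a s : a *: tcls s = tcls (map (tscal a) s).
Proof. exact: tscale_cls. Qed.

Definition tpure (x : M) (y : N) : tensor := tcls [:: (x, y)].

End TensorRelation.

Notation "M ⊗ N" := (tensor M N : lmodType _) (at level 40, left associativity).
Notation "x \ox y" := (tpure x y) (at level 40, left associativity).

Section TensorUniversal.
Variables (k : fieldType) (M N P : lmodType k).

Lemma tpure_bilinear : bilinear_for *:%R *:%R (@tpure k M N).
Proof.
split=> [y a x x'|x a y y']; rewrite /tpure /=.
  rewrite tclsZ tclsD; apply/eqP/tclsP; exact: teq_Dl.
rewrite tclsZ tclsD; apply/eqP/tclsP.
apply: (teq_trans (teq_Dr _ _ _)).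
exact: (teq_cat (teq_sym (teq_Z _ _ _)) (teq_refl [:: (x, y')])).
Qed.

Lemma tensor_sum (t : M ⊗ N) : t = \sum_(p <- trep t) p.1 \ox p.2.
Proof.
rewrite -[LHS]trepK; elim: (trep t) => [|[x y] s IH]; first by rewrite big_nil.
by rewrite big_cons -IH tclsD.
Qed.

Lemma tensor_ext (f g : {linear M ⊗ N -> P}) :
  (forall x y, f (x \ox y) = g (x \ox y)) -> f =1 g.
Proof.
by move=> h t; rewrite (tensor_sum t) !linear_sum; apply: eq_bigr => p _.
Qed.

Definition tlift_fun (f : M -> N -> P) (hf : bilinear_for *:%R *:%R f)
  (t : M ⊗ N) : P := \sum_(p <- trep t) f p.1 p.2.

Variables (f : M -> N -> P) (hf : bilinear_for *:%R *:%R f).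


Fact tlift_zero y : f 0 y = 0.
Proof. by have := hf.1 y (-1) 0 0; rewrite /= scaler0 addr0 scaleN1r addNr. Qed.

Fact tlift_teq s t :
  teq s t -> \sum_(p <- s) f p.1 p.2 = \sum_(p <- t) f p.1 p.2.
Proof.
have Zl a x y : f (a *: x) y = a *: f x y.
  by have := hf.1 y a x 0; rewrite /= !addr0 tlift_zero addr0.
have Dl x x' y : f (x + x') y = f x y + f x' y.
  by have := hf.1 y 1 x x'; rewrite /= !scale1r.
have Dr x y y' : f x (y + y') = f x y + f x y'.
  by have := hf.2 x 1 y y'; rewrite /= !scale1r.
have r0 x : f x 0 = 0 by apply: (addrI (f x 0)); rewrite -Dr !addr0.
have Zr a x y : f x (a *: y) = a *: f x y.
  by have := hf.2 x a y 0; rewrite /= !addr0 r0 addr0.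
elim=> [u|u v _ h|u v w _ h _ h'|u u' v v' _ h _ h'|u v|x x' y|x y y'|b x y|y].
- by [].
- by rewrite h.
- by rewrite h h'.
- by rewrite !big_cat /= h h'.
- by rewrite !big_cat /= addrC.
- by rewrite !big_cons !big_nil /= !addr0.
- by rewrite !big_cons !big_nil /= !addr0.
- by rewrite !big_cons !big_nil /= Zl Zr.
- by rewrite !big_cons !big_nil /= tlift_zero addr0.
Qed.

Fact tlift_cls s : tlift_fun hf (tcls s) = \sum_(p <- s) f p.1 p.2.
Proof. by apply: tlift_teq; apply: trep_cls. Qed.

Fact tlift_linear : linear (tlift_fun hf).
Proof.
move=> a t u; rewrite -(trepK t) -(trepK u) tclsZ tclsD.
rewrite !tlift_cls big_cat big_map scaler_sumr /=.
congr (_ + _); apply: eq_bigr => p _.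
by have := hf.1 p.2 a p.1 0; rewrite /= addr0 tlift_zero addr0.
Qed.

HB.instance Definition _ :=
  GRing.isLinear.Build k (M ⊗ N) P *:%R (tlift_fun hf) tlift_linear.

Definition tlift : {linear M ⊗ N -> P} :=
  locked (tlift_fun hf : {linear M ⊗ N -> P}).

Lemma tliftE x y : tlift (x \ox y) = f x y.
Proof. by rewrite /tlift -lock [LHS]tlift_cls big_seq1. Qed.

End TensorUniversal.

Section TensorMaps.
Variable k : fieldType.
Implicit Types M N P Q : lmodType k.

Lemma tlift_comb M N P (f g h : M -> N -> P)
    (hf : bilinear_for *:%R *:%R f) (hg : bilinear_for *:%R *:%R g)
    (hh : bilinear_for *:%R *:%R h) a t :
  (forall x y, f x y = a *: g x y + h x y) ->
  tlift hf t = a *: tlift hg t + tlift hh t.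
Proof.
move=> e; rewrite /tlift -!lock /= /tlift_fun scaler_sumr -big_split /=.
by apply: eq_bigr => p _; rewrite e.
Qed.

(* [tmap f g] is the linear map f (x) g. *)
Fact tmap_bilinear M N M' N' (f : {linear M -> M'}) (g : {linear N -> N'}) :
  bilinear_for *:%R *:%R (fun x y => f x \ox g y).
Proof.
split=> [y a x x'|x a y y'] /=; rewrite linearP.
  exact: (tpure_bilinear _ _).1.
exact: (tpure_bilinear _ _).2.
Qed.

Definition tmap M N M' N' (f : {linear M -> M'}) (g : {linear N -> N'}) :
  {linear M ⊗ N -> M' ⊗ N'} := tlift (tmap_bilinear f g).

Lemma tmapE M N M' N' (f : {linear M -> M'}) (g : {linear N -> N'}) x y :
  tmap f g (x \ox y) = f x \ox g y.
Proof. exact: tliftE. Qed.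

(* The identification k (x) k = k. *)
Fact tscalar_bilinear :
  bilinear_for *:%R *:%R (fun a b : k^o => a * b : k^o).
Proof.
split=> [y a x x'|x a y y'] /=; first by rewrite mulrDl -scalerAl.
by rewrite mulrDr -scalerAr.
Qed.

Definition tscalar : {linear k^o ⊗ k^o -> k^o} := tlift tscalar_bilinear.

Fact tassoc1_bilinear M N P (z : P) :
  bilinear_for *:%R *:%R (fun (x : M) (y : N) => x \ox (y \ox z)).
Proof.
split=> [y a x x'|x a y y'] /=; first by rewrite (tpure_bilinear _ _).1.
by rewrite (tpure_bilinear _ _).1 (tpure_bilinear _ _).2.
Qed.

Fact tassoc_bilinear M N P :
  bilinear_for *:%R *:%R
    (fun (t : M ⊗ N) (z : P) => tlift (tassoc1_bilinear M N z) t).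
Proof.
split=> [z a t t'|t a z z']; first by rewrite linearP.
by apply: tlift_comb => x y; rewrite !(tpure_bilinear _ _).2.
Qed.

Definition tassoc M N P : {linear (M ⊗ N) ⊗ P -> M ⊗ (N ⊗ P)} :=
  tlift (tassoc_bilinear M N P).

Lemma tassocE M N P (x : M) (y : N) (z : P) :
  tassoc M N P ((x \ox y) \ox z) = x \ox (y \ox z).
Proof. by rewrite !tliftE. Qed.

(* [tswap] is the map id (x) swap (x) id. *)
Fact tswap1_bilinear M N P Q (x : M) (y : N) :
  bilinear_for *:%R *:%R (fun (z : P) (w : Q) => (x \ox z) \ox (y \ox w)).
Proof.
split=> [w a z z'|z a w w'] /=.
  by rewrite (tpure_bilinear _ _).2 (tpure_bilinear _ _).1.
by rewrite !(tpure_bilinear _ _).2.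
Qed.

Fact tswap2_bilinear M N P Q (u : P ⊗ Q) :
  bilinear_for *:%R *:%R
    (fun (x : M) (y : N) => tlift (tswap1_bilinear P Q x y) u).
Proof.
split=> [y a x x'|x a y y']; apply: tlift_comb => z w.
  by rewrite !(tpure_bilinear _ _).1.
by rewrite (tpure_bilinear _ _).1 (tpure_bilinear _ _).2.
Qed.

Fact tswap_bilinear M N P Q :
  bilinear_for *:%R *:%R
    (fun (t : M ⊗ N) (u : P ⊗ Q) => tlift (tswap2_bilinear M N u) t).
Proof.
split=> [u a t t'|t a u u']; first by rewrite linearP.
by apply: tlift_comb => x y; rewrite linearP.
Qed.

Definition tswap M N P Q :
  {linear (M ⊗ N) ⊗ (P ⊗ Q) -> (M ⊗ P) ⊗ (N ⊗ Q)} :=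
  tlift (tswap_bilinear M N P Q).

Lemma tswapE M N P Q (x : M) (y : N) (z : P) (w : Q) :
  tswap M N P Q ((x \ox y) \ox (z \ox w)) = (x \ox z) \ox (y \ox w).
Proof. by rewrite !tliftE. Qed.

End TensorMaps.

(* Vector species: functors from finite sets with bijections to k-spaces.     *)
Record species (k : fieldType) := Species {
  sp_obj :> finType -> lmodType k;
  sp_map : forall (X Y : finType) (f : X -> Y),
    bijective f -> {linear sp_obj X -> sp_obj Y};
  sp_id : forall (X : finType) (h : bijective (@id X)) x, sp_map h x = x;
  sp_comp : forall (X Y Z : finType) (f : X -> Y) (g : Y -> Z)
      (hf : bijective f) (hg : bijective g) (hgf : bijective (g \o f)) x,
    sp_map hgf x = sp_map hg (sp_map hf x)
}.

(* A subset of a finite type, regarded as a finite set in its own right. The  *)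
(* finite sets occurring in (de)compositions are subsets of an ambient finite *)
(* type U; for X : finType, X itself is the case of [set: X].                 *)
Definition fin (U : finType) (A : {set U}) : finType := {x : U | x \in A}.

(* I is the disjoint union of S and T. *)
Definition disj_union (U : finType) (I S T : {set U}) : bool :=
  (S :|: T == I) && [disjoint S & T].

Definition restricts_to (U V : finType) (I S : {set U}) (J S' : {set V})
    (s : fin I -> fin J) (s' : fin S -> fin S') : Prop :=
  forall (i : fin I) (a : fin S), val i = val a -> val (s i) = val (s' a).

(* [hm_unit] and [hm_counit] are the two directions of the identification     *)
(* H[empty] = k; there is one empty subset in each ambient type, and they are *)
(* identified by naturality. In the compatibility axiom the last four         *)
(* disjointness conditions follow from the first two.                         *)
Record hopf_monoid (k : fieldType) := HopfMonoid {
  hm_species :> species k;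

  hm_unit : forall U : finType, {linear k^o -> hm_species (fin (set0 : {set U}))};
  hm_counit : forall U : finType, {linear hm_species (fin (set0 : {set U})) -> k^o};
  hm_unitK : forall U : finType, cancel (@hm_unit U) (@hm_counit U);
  hm_counitK : forall U : finType, cancel (@hm_counit U) (@hm_unit U);
  hm_unit_natural : forall (U V : finType)
      (s : fin (set0 : {set U}) -> fin (set0 : {set V})) (hs : bijective s) a,
    sp_map hm_species hs (hm_unit U a) = hm_unit V a;

  hm_mul : forall (U : finType) (I S T : {set U}), disj_union I S T ->
    {linear hm_species (fin S) ⊗ hm_species (fin T) -> hm_species (fin I)};
  hm_comul : forall (U : finType) (I S T : {set U}), disj_union I S T ->
    {linear hm_species (fin I) -> hm_species (fin S) ⊗ hm_species (fin T)};

  hm_mul_natural : forall (U V : finType) (I S T : {set U}) (J S' T' : {set V})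
      (h : disj_union I S T) (h' : disj_union J S' T')
      (s : fin I -> fin J) (sS : fin S -> fin S') (sT : fin T -> fin T')
      (hs : bijective s) (hsS : bijective sS) (hsT : bijective sT),
    restricts_to s sS -> restricts_to s sT ->
    forall t, sp_map hm_species hs (hm_mul h t) =
      hm_mul h' (tmap (sp_map hm_species hsS) (sp_map hm_species hsT) t);
  hm_comul_natural : forall (U V : finType) (I S T : {set U})
      (J S' T' : {set V}) (h : disj_union I S T) (h' : disj_union J S' T')
      (s : fin I -> fin J) (sS : fin S -> fin S') (sT : fin T -> fin T')
      (hs : bijective s) (hsS : bijective sS) (hsT : bijective sT),
    restricts_to s sS -> restricts_to s sT ->
    forall x, hm_comul h' (sp_map hm_species hs x) =
      tmap (sp_map hm_species hsS) (sp_map hm_species hsT) (hm_comul h x);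

  hm_mul1 : forall (U : finType) (I : {set U}) (h : disj_union I I set0) x a,
    hm_mul h (x \ox hm_unit U a) = a *: x;
  hm_1mul : forall (U : finType) (I : {set U}) (h : disj_union I set0 I) x a,
    hm_mul h (hm_unit U a \ox x) = a *: x;
  hm_comul1 : forall (U : finType) (I : {set U}) (h : disj_union I I set0) x,
    hm_comul h x = x \ox hm_unit U 1;
  hm_1comul : forall (U : finType) (I : {set U}) (h : disj_union I set0 I) x,
    hm_comul h x = hm_unit U 1 \ox x;

  hm_mulA : forall (U : finType) (I R S T RS ST : {set U})
      (h1 : disj_union ST S T) (h2 : disj_union I R ST)
      (h3 : disj_union RS R S) (h4 : disj_union I RS T) t,
    hm_mul h2 (tmap idfun (hm_mul h1) (tassoc _ _ _ t)) =
    hm_mul h4 (tmap (hm_mul h3) idfun t);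
  hm_comulA : forall (U : finType) (I R S T RS ST : {set U})
      (h1 : disj_union ST S T) (h2 : disj_union I R ST)
      (h3 : disj_union RS R S) (h4 : disj_union I RS T) x,
    tmap idfun (hm_comul h1) (hm_comul h2 x) =
    tassoc _ _ _ (tmap (hm_comul h3) idfun (hm_comul h4 x));

  hm_compat : forall (U : finType) (I S T S' T' : {set U})
      (h : disj_union I S T) (h' : disj_union I S' T')
      (hS : disj_union S (S :&: S') (S :&: T'))
      (hT : disj_union T (T :&: S') (T :&: T'))
      (hS' : disj_union S' (S :&: S') (T :&: S'))
      (hT' : disj_union T' (S :&: T') (T :&: T')) t,
    hm_comul h' (hm_mul h t) =
    tmap (hm_mul hS') (hm_mul hT')
      (tswap _ _ _ _ (tmap (hm_comul hS) (hm_comul hT) t))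
}.

Record character (k : fieldType) (H : hopf_monoid k) := Character {
  chr :> forall X : finType, {linear H X -> k^o};
  chr_natural : forall (X Y : finType) (f : X -> Y) (hf : bijective f) x,
    chr Y (sp_map H hf x) = chr X x;
  chr_mul : forall (U : finType) (I S T : {set U}) (h : disj_union I S T)
      (x : H (fin S)) (y : H (fin T)),
    chr (fin I) (hm_mul H h (x \ox y)) = chr (fin S) x * chr (fin T) y;
  chr_unit : forall U : finType, chr (fin set0) (hm_unit H U 1) = 1
}.

Section Decompositions.
Variable U : finType.
Implicit Types (I S : {set U}) (s : seq {set U}).

Definition decomposition I s : bool :=
  (\bigcup_(A <- s) A == I) && pairwise (fun A B : {set U} => [disjoint A & B]) s.

Definition composition I s : bool := decomposition I s && (set0 \notin s).

Fact decomposition_nil I : decomposition I [::] -> I = set0.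
Proof. by rewrite /decomposition big_nil andbT => /eqP. Qed.

Fact decomposition_one I S : decomposition I [:: S] -> I = S.
Proof. by rewrite /decomposition big_seq1 => /andP[/eqP]. Qed.

Fact disjoint_bigcup S s :
  all (fun B : {set U} => [disjoint S & B]) s -> [disjoint S & \bigcup_(A <- s) A].
Proof.
elim: s => [_|B s IH /= /andP[hB /IH h]]; rewrite -setI_eq0.
  by rewrite big_nil setI0.
by rewrite big_cons setIUr setU_eq0 !setI_eq0 hB.
Qed.

Fact decomposition_head I S s :
  decomposition I (S :: s) -> disj_union I S (\bigcup_(A <- s) A).
Proof.
rewrite /decomposition big_cons /= => /and3P[/eqP <- h _].
by rewrite /disj_union eqxx disjoint_bigcup.
Qed.

Fact decomposition_tail I S s :
  decomposition I (S :: s) -> decomposition (\bigcup_(A <- s) A) s.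
Proof. by rewrite /decomposition /= eqxx => /and3P[]. Qed.

End Decompositions.

Section Chi.
Variables (k : fieldType) (H : hopf_monoid k).

(* The identity map H[I] -> H[J] when I = J. *)
Definition hcast (U : finType) (I J : {set U}) (e : I = J) :
    {linear H (fin I) -> H (fin J)} :=
  match e in _ = K return {linear H (fin I) -> H (fin K)} with
  | erefl => idfun
  end.

(* H[S_1] (x) ... (x) H[S_k], which is k for k = 0 and H[S_1] for k = 1. *)
Fixpoint tensors (U : finType) (s : seq {set U}) : lmodType k :=
  match s with
  | [::] => k^o
  | A :: s' =>
    match s' with
    | [::] => H (fin A)
    | _ :: _ => H (fin A) ⊗ tensors s'
    end
  end.

Fixpoint iter_comul (U : finType) (s : seq {set U}) :
    forall I : {set U}, decomposition I s -> {linear H (fin I) -> tensors s} :=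
  match s return forall I : {set U}, decomposition I s ->
    {linear H (fin I) -> tensors s} with
  | [::] => fun I h => hm_counit H U \o hcast (decomposition_nil h)
  | A :: s' =>
    match s' return
      (forall J : {set U}, decomposition J s' ->
        {linear H (fin J) -> tensors s'}) ->
      forall I : {set U}, decomposition I (A :: s') ->
        {linear H (fin I) -> tensors (A :: s')} with
    | [::] => fun _ I h => hcast (decomposition_one h)
    | _ :: _ => fun rec I h =>
      tmap idfun (rec _ (decomposition_tail h))
        \o hm_comul H (decomposition_head h)
    end (@iter_comul U s')
  end.

Variable zeta : character H.

(* zeta_{S_1} (x) ... (x) zeta_{S_k}, with values in k (x) ... (x) k = k. *)
Fixpoint tensor_chr (U : finType) (s : seq {set U}) : {linear tensors s -> k^o} :=
  match s return {linear tensors s -> k^o} with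
  | [::] => idfun
  | A :: s' =>
    match s' return {linear tensors s' -> k^o} ->
        {linear tensors (A :: s') -> k^o} with
    | [::] => fun _ => zeta (fin A)
    | _ :: _ => fun rec => tscalar k \o tmap (zeta (fin A)) rec
    end (tensor_chr s')
  end.

Definition chi (U : finType) (I : {set U}) (x : H (fin I)) (n : nat) : k :=
  \sum_(s : {s : n.-tuple {set U} | decomposition I s})
    tensor_chr (val s) (iter_comul (valP s) x).

Fact composition_decomposition (U : finType) (I : {set U}) (s : seq {set U}) :
  composition I s -> decomposition I s.
Proof. by case/andP. Qed.

Definition chi_coef (U : finType) (I : {set U}) (x : H (fin I)) (j : nat) : k :=
  \sum_(s : {s : j.-tuple {set U} | composition I s})
    tensor_chr (val s) (iter_comul (composition_decomposition (valP s)) x).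

End Chi.

(* Main.v *)
Require Import Defs.
From mathcomp Require Import all_boot all_order all_algebra.

(** Both parts rest on three properties of the linear functional [zeta_comul],
    which sends [x] to (zeta_{S_1} ⊗ ... ⊗ zeta_{S_n}) Δ_{S_1,...,S_n}(x).

    - It satisfies a single recursion: for a head [A] followed by a rest
      decomposing [J], it is (zeta_A ⊗ rest) ∘ Δ_{A,J}, also when the rest is
      the empty sequence ([zeta_comul_cons]). The other two properties are
      inductions on this recursion.
    - Deleting the empty parts does not change it ([zeta_comul_filter]), since
      Δ_{∅,I}(x) = 1 ⊗ x and zeta_∅(1) = 1.
    - It is invariant under bijections ([zeta_comul_natural]), since Δ and zeta
      are natural and a bijection I -> J restricts to matching parts.

    For the first part, group the decompositions into n parts by the composition
    that remains after the empty parts are deleted. A composition with j parts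
    arises from exactly C(n, j) decompositions, one for each choice of the
    positions of its parts, and it has at most |I| parts. The count is carried
    out for an arbitrary function on sequences over a finite type, by induction
    on n with Pascal's rule ([sum_tuple_filter]). In characteristic 0, C(n, j)
    is the value at n of a polynomial of degree j, whence the polynomial.

    For the second part, taking images along I -> J is a bijection from the
    decompositions of I onto those of J which preserves the summands. *)

Set Implicit Arguments.
Unset Strict Implicit.
Unset Printing Implicit Defensive.

Import GRing.Theory.
Local Open Scope ring_scope.

(** * Tuples grouped by what remains after deleting one letter *)

Section TupleSums.
Variables (R : pzRingType) (T : finType) (e : T).
Implicit Type g : seq T -> R.

Lemma sum_tuple_cons n g :
  \sum_(t : n.+1.-tuple T) g t = \sum_a \sum_(t : n.-tuple T) g (a :: t).
Proof.
rewrite pair_big /= (reindex (fun p : T * n.-tuple T => [tuple of p.1 :: p.2])) //=.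
exists (fun t => (thead t, [tuple of behead t])) => [[a t] _|t _] /=.
  by congr (_, _); apply: val_inj.
by rewrite -tuple_eta.
Qed.

Lemma sum_tuple0 g : \sum_(t : 0.-tuple T) g t = g [::].
Proof. by rewrite (bigD1 [tuple]) //= big1 ?addr0 // => t; rewrite tuple0. Qed.

(** A sequence without [e] of length j is the [e]-free part of C(n, j) tuples of
    length n. The bound [m] is left free because the induction uses it at
    different values on the two sides of Pascal's rule: a tuple starting with
    [e] contributes the terms C(n, j), and one starting with another entry the
    terms C(n, j - 1). *)
Lemma sum_tuple_filter n m g : (n < m)%N ->
  \sum_(t : n.-tuple T) g (filter (predC1 e) t) =
  \sum_(j < m) (\sum_(c : j.-tuple T | e \notin (c : seq T)) g c) * 'C(n, j)%:R.
Proof.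
elim: n m g => [|n IH] [//|m] g lt_nm.
  rewrite big_ord_recl (sum_tuple0 (fun t => g (filter _ t))) big_mkcond.
  rewrite (sum_tuple0 (fun c => if e \notin c then g c else 0)) /=.
  by rewrite mulr1 big1 ?addr0 // => j _; rewrite mulr0.
rewrite (sum_tuple_cons _ (fun t => g (filter _ t))) (bigD1 e) //= eqxx /=.
(* The tuples starting with [e] need the bound m + 1, the others m. *)
rewrite (IH m.+1) ?(ltnW lt_nm) //.
have -> : \sum_(a | a != e) \sum_(t : n.-tuple T)
     g (if a != e then a :: filter (predC1 e) t else filter (predC1 e) t) =
   \sum_(a | a != e) \sum_(j < m)
     (\sum_(c : j.-tuple T | e \notin (c : seq T)) g (a :: c)) * 'C(n, j)%:R.
  apply: eq_bigr => a ae; rewrite -(IH m (fun t => g (a :: t))) //.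
  by apply: eq_bigr => t _; rewrite ae.
rewrite exchange_big /= !big_ord_recl !bin0 -addrA; congr (_ + _).
rewrite -big_split /=; apply: eq_bigr => j _.
rewrite /bump /= add1n binS natrD mulrDr; congr (_ + _).
rewrite -mulr_suml; congr (_ * _); rewrite [RHS]big_mkcond.
rewrite (sum_tuple_cons _ (fun c => if e \notin c then g c else 0)) [LHS]big_mkcond.
apply: eq_bigr => a _; rewrite eq_sym -[RHS]big_mkcond; have [->|ae] := eqVneq e a.
  by rewrite /= [RHS]big_pred0 // => c; rewrite in_cons eqxx.
by apply: eq_bigl => c; rewrite in_cons (negPf ae).
Qed.

End TupleSums.

(** * Binomial coefficients as polynomials *)

Section Polynomial.
Variable k : fieldType.

Definition binom_poly j : {poly k} := (j`!%:R)^-1 *: \prod_(i < j) ('X - (i%:R)%:P).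

Lemma size_binom_poly j : (size (binom_poly j) <= j.+1)%N.
Proof.
apply: leq_trans (size_scale_leq _ _) _.
by rewrite -big_enum /= (size_prod_XsubC _ (fun i : 'I_j => i%:R)) size_enum_ord.
Qed.

Lemma horner_binom_poly (char0 : [pchar k] =i pred0) j n :
  (binom_poly j).[n%:R] = 'C(n, j)%:R.
Proof.
have fact_neq0 : (j`!%:R : k) != 0.
  by rewrite ((pcharf0P k).1 char0) -lt0n fact_gt0.
have ffact_prod : \prod_(i < j) (n%:R - i%:R) = (n ^_ j)%:R :> k.
  elim: j {fact_neq0} => [|j IH]; first by rewrite big_ord0.
  rewrite big_ord_recr /= IH ffactnSr natrM.
  have [le_jn|lt_nj] := leqP j n; first by rewrite natrB.
  by rewrite ffact_small // !mul0r.
rewrite /binom_poly hornerZ horner_prod.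
under eq_bigr do rewrite hornerXsubC.
by rewrite ffact_prod -bin_ffact natrM mulrC mulfK.
Qed.

End Polynomial.

(** * Decompositions and multiplicities *)

Section Decompositions.
Variable U : finType.
Implicit Types (I J A : {set U}) (s : seq {set U}).

Lemma mem_bigcup_seq s u :
  (u \in \bigcup_(A <- s) A) = has (fun A : {set U} => u \in A) s.
Proof.
elim: s => [|A s IH]; first by rewrite big_nil inE.
by rewrite big_cons inE IH.
Qed.

(** Counting how many parts contain a point turns a decomposition into a
    pointwise condition, which is visibly stable under deletion of empty parts
    and under bijections. *)
Lemma decompositionP I s :
  reflect (forall u, count (fun A : {set U} => u \in A) s = (u \in I) :> nat)
          (decomposition I s).
Proof.
elim: s I => [|A s IH] I.
  rewrite /decomposition big_nil andbT; apply: (iffP eqP) => [<- u|h].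
    by rewrite inE.
  by apply/setP => u; have := h u; rewrite inE /=; case: (u \in I).
apply: (iffP idP) => [h u | h].
  have /IH /(_ u) /= -> := decomposition_tail h.
  have /andP[/eqP <- /pred0P /(_ u) /= dis] := decomposition_head h.
  by rewrite inE; move: dis; case: (u \in A); case: (u \in _).
have dis B : B \in s -> [disjoint A & B].
  move=> Bs; apply/pred0P => u /=; apply/negbTE/andP => -[uA uB].
  have : has (fun C : {set U} => u \in C) s by apply/hasP; exists B.
  by have := h u; rewrite has_count /= uA; case: (u \in I); case: count.
have /andP[_ pw] : decomposition (I :\: A) s.
  apply/IH => u; have := h u; rewrite inE /=.
  by case: (u \in A); case: (u \in I); case: count => [|[]].
apply/and3P; split=> //; last by apply/allP.
apply/eqP/setP => u; rewrite mem_bigcup_seq has_count h.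
by case: (u \in I).
Qed.

Lemma decomposition_cons I J A s :
  disj_union I A J -> decomposition I (A :: s) -> J = \bigcup_(B <- s) B.
Proof.
move=> /andP[/eqP <- /pred0P d] /decomposition_head /andP[/eqP e /pred0P d'].
apply/setP => u; have := d u; have := d' u; have /setP/(_ u) := e.
by rewrite /= !inE; case: (u \in A); case: (u \in J); case: (u \in _).
Qed.

Lemma disj_union_sub I S T : disj_union I S T -> (S \subset I) && (T \subset I).
Proof. by move=> /andP[/eqP <- _]; rewrite subsetUl subsetUr. Qed.

Lemma decomposition_sub I s A : decomposition I s -> A \in s -> A \subset I.
Proof.
move=> /decompositionP d As; apply/subsetP => u uA; have := d u.
have : has (fun B : {set U} => u \in B) s by apply/hasP; exists A.
by rewrite has_count => + e; rewrite e; case: (u \in I).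
Qed.

Lemma decomposition_filter I s :
  decomposition I (filter (predC1 set0) s) = decomposition I s.
Proof.
have e u : count (fun A : {set U} => u \in A) (filter (predC1 set0) s) =
           count (fun A : {set U} => u \in A) s.
  rewrite count_filter; apply: eq_count => A /=; have [->|_] := eqVneq.
    by rewrite inE.
  by rewrite andbT.
by apply/decompositionP/decompositionP => h u; rewrite -(h u) e.
Qed.

(** The cardinals of the parts are positive and add up to that of [I], as
    double counting of the incidences shows. *)
Lemma composition_size I s : composition I s -> (size s <= #|I|)%N.
Proof.
move=> /andP[/decompositionP d n0].
have -> : #|I| = (\sum_(A <- s) #|A|)%N.
  transitivity (\sum_u count (fun A : {set U} => u \in A) s)%N.
    by rewrite -sum1_card big_mkcond; apply: eq_bigr => u _; rewrite d; case: ifP.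
  under eq_bigr do rewrite -sum1_count big_mkcond.
  rewrite exchange_big; apply: eq_bigr => A _.
  by rewrite -big_mkcond sum1_card.
rewrite -sum1_size big_seq [leqRHS]big_seq; apply: leq_sum => A As.
by rewrite card_gt0; apply: contraNneq n0 => <-.
Qed.

End Decompositions.

(** * Transport of decompositions along bijections *)

Section Transport.
Variables (U V : finType) (I : {set U}) (J : {set V}).
Implicit Types (f : fin I -> fin J) (A : {set U}).

(** Within [J], [A'] agrees with the image of the part of [A] within [I]; the
    pointwise form passes to restrictions of [f] at once. *)
Definition transports f A (A' : {set V}) :=
  forall a : fin I, (val a \in A) = (val (f a) \in A').

Lemma restriction f A (A' : {set V}) : A \subset I -> transports f A A' ->
  exists g : fin A -> fin A', restricts_to f g.
Proof.
move=> /subsetP sAI tf.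
pose inI (a : fin A) : fin I := Sub (val a) (sAI _ (valP a)).
have inA' a : val (f (inI a)) \in A' by rewrite -tf /= (valP a).
exists (fun a => Sub (val (f (inI a))) (inA' a)) => i a eia /=.
by congr (val (f _)); apply: val_inj.
Qed.

Lemma transports_bigcup f (h : {set U} -> {set V}) (s : seq {set U}) :
  {in s, forall A, transports f A (h A)} ->
  transports f (\bigcup_(A <- s) A) (\bigcup_(A' <- map h s) A').
Proof.
move=> tr a; rewrite !mem_bigcup_seq has_map.
by apply: eq_in_has => A /tr.
Qed.

Definition push f A : {set V} :=
  [set val (f a) | a in [set a : fin I | val a \in A]].

Lemma push_sub f A : push f A \subset J.
Proof. by apply/subsetP => v /imsetP[a _ ->]; apply: valP. Qed.

Lemma transports_push f A : injective f -> transports f A (push f A).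
Proof.
move=> inj_f a; apply/idP/imsetP => [aA|[b]]; first by exists a; rewrite ?inE.
by rewrite inE => bA /val_inj /inj_f ->.
Qed.

(** A point of [J] lies in as many images as its preimage lies in parts; a point
    outside [J] lies in none. *)
Lemma decomposition_push f (s : seq {set U}) :
  bijective f -> decomposition I s -> decomposition J (map (push f) s).
Proof.
move=> [f' fK f'K] /decompositionP d; apply/decompositionP => v.
rewrite count_map; have [vJ|vJ] := boolP (v \in J); last first.
  rewrite (@eq_count _ _ pred0) ?count_pred0 // => A /=.
  by apply: contraNF vJ => /(subsetP (push_sub f A)).
pose b : fin J := Sub v vJ.
rewrite -[RHS]/(nat_of_bool true) -(valP (f' b)) -d; apply: eq_count => A /=.
by rewrite (transports_push A (can_inj fK)) f'K.
Qed.

End Transport.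

(** The restrictions of [f] and of its inverse are inverse to each other, since
    their underlying values are those of [f] and its inverse. *)
Lemma restriction_bij (U V : finType) (I A : {set U}) (J A' : {set V})
    (f : fin I -> fin J) :
  bijective f -> A \subset I -> A' \subset J -> transports f A A' ->
  exists2 g : fin A -> fin A', bijective g & restricts_to f g.
Proof.
move=> [f' fK f'K] sAI sAJ tf.
have tf' : transports f' A' A by move=> b; rewrite tf f'K.
have [g rg] := restriction sAI tf; have [g' rg'] := restriction sAJ tf'.
exists g => //; exists g' => [a|b]; apply: val_inj.
  pose i : fin I := Sub (val a) (subsetP sAI _ (valP a)).
  by rewrite -(rg' (f i)) ?fK //; apply: rg.
pose j : fin J := Sub (val b) (subsetP sAJ _ (valP b)).
by rewrite -(rg (f' j)) ?f'K //; apply: rg'.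
Qed.

Lemma pushK (U V : finType) (I A : {set U}) (J : {set V})
    (f : fin I -> fin J) f' :
  cancel f f' -> A \subset I -> push f' (push f A) = A.
Proof.
move=> fK /subsetP sAI; apply/setP => u; apply/imsetP/idP.
  move=> [b]; rewrite inE => /imsetP[a].
  by rewrite inE => aA /val_inj -> ->; rewrite fK.
move=> uA; pose a : fin I := Sub u (sAI _ uA).
by exists (f a); rewrite ?inE ?fK // -(transports_push _ (can_inj fK)).
Qed.

(** * Characters on iterated coproducts *)

Section Evaluation.
Variables (k : fieldType) (H : hopf_monoid k) (zeta : character H).

Definition zeta_comul (U : finType) (I : {set U}) s (h : decomposition I s) :
  {linear H (fin I) -> k^o} := tensor_chr zeta s \o iter_comul H h.

(** The functional f ⊗ g, with values in k ⊗ k = k. *)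
Definition tprod (M N : lmodType k) (f : {linear M -> k^o})
  (g : {linear N -> k^o}) : {linear M ⊗ N -> k^o} := tscalar k \o tmap f g.

Implicit Types M N : lmodType k.

Lemma tprodE M N (f : {linear M -> k^o}) (g : {linear N -> k^o}) x y :
  tprod f g (x \ox y) = f x * g y.
Proof. by rewrite /tprod /= tmapE tliftE. Qed.

Lemma eq_tprod M N (f f' : {linear M -> k^o}) (g g' : {linear N -> k^o}) :
  f =1 f' -> g =1 g' -> tprod f g =1 tprod f' g'.
Proof. by move=> ef eg; apply: tensor_ext => x y; rewrite !tprodE ef eg. Qed.

Lemma tprod_tmap (M N M' N' : lmodType k)
    (f : {linear M' -> k^o}) (g : {linear N' -> k^o})
    (f' : {linear M -> M'}) (g' : {linear N -> N'}) t :
  tprod f g (tmap f' g' t) = tprod (f \o f') (g \o g') t.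
Proof.
have := @tensor_ext k M N k^o (tprod f g \o tmap f' g') (tprod (f \o f') (g \o g')).
move/(_ _ t); apply=> x y.
by rewrite tprodE -[LHS]/(tprod f g (tmap f' g' (x \ox y))) tmapE tprodE.
Qed.

Section Fixed.
Variable U : finType.
Implicit Types (I J A : {set U}) (s : seq {set U}).

Lemma zeta_comul_irr I s (h h' : decomposition I s) :
  zeta_comul h =1 zeta_comul h'.
Proof. by rewrite (bool_irrelevance h h'). Qed.

Lemma zeta_comul_nil (h : decomposition set0 [::]) (x : H (fin (set0 : {set U}))) :
  zeta_comul h x = hm_counit H U x.
Proof.
rewrite /zeta_comul /=; move: (decomposition_nil h) => e.
by rewrite (eq_axiomK e).
Qed.

(** The iterated coproduct treats a single part separately, but the uniform
    recursion still holds there: the rest is then empty, and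
    Δ_{I,∅}(x) = x ⊗ 1 with counit 1 on the right factor. *)
Lemma zeta_comul_cons I J A s (h : decomposition I (A :: s))
    (hd : disj_union I A J) (ht : decomposition J s) x :
  zeta_comul h x = tprod (zeta (fin A)) (zeta_comul ht) (hm_comul H hd x).
Proof.
have eJ := decomposition_cons hd h; subst J.
rewrite (bool_irrelevance hd (decomposition_head h)).
rewrite (bool_irrelevance ht (decomposition_tail h)) {hd ht}.
case: s h => [|B s] h; last first.
  rewrite {1}/zeta_comul [iter_comul]lock /= -lock.
  by rewrite -[LHS]/(tprod _ _ _) tprod_tmap; apply: eq_tprod.
move: (decomposition_head h) (decomposition_tail h); rewrite big_nil => hd ht.
have eA := decomposition_one h; subst A; rewrite hm_comul1 tprodE zeta_comul_nil.
rewrite hm_unitK mulr1 /zeta_comul /=.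
by rewrite (eq_axiomK (decomposition_one h)).
Qed.

(** An empty head contributes the factor zeta_∅(1) = 1. *)
Lemma zeta_comul_filter I s (h : decomposition I s)
    (h' : decomposition I (filter (predC1 set0) s)) x :
  zeta_comul h x = zeta_comul h' x.
Proof.
elim: s I h h' x => [|A s IH] I h h' x; first exact: zeta_comul_irr.
have hd := decomposition_head h; have ht := decomposition_tail h.
move: (\bigcup_(B <- s) B) hd ht => J hd ht; move: h'.
have ht' : decomposition J (filter (predC1 set0) s) by rewrite decomposition_filter.
rewrite (zeta_comul_cons h hd ht).
have [A0|An0] := eqVneq A set0; last first.
  have -> : filter (predC1 set0) (A :: s) = A :: filter (predC1 set0) s.
    by rewrite /= An0.
  move=> h'; rewrite (zeta_comul_cons h' hd ht').
  by apply: eq_tprod => // y; apply: IH.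
subst A; have eJ : I = J by case/andP: (hd) => /eqP <-; rewrite set0U.
have -> : filter (predC1 set0) (set0 :: s) = filter (predC1 set0) s.
  by rewrite /= eqxx.
subst J; rewrite hm_1comul tprodE chr_unit mul1r => h'; exact: IH.
Qed.

(** The summand extended by zero to all sequences of subsets, so that sums over
    decompositions become sums over tuples. *)
Definition zeta_term I (x : H (fin I)) s : k :=
  if insub s is Some d then zeta_comul (valP (d : {s | decomposition I s})) x else 0.

Lemma zeta_termE I (x : H (fin I)) s (h : decomposition I s) :
  zeta_term x s = zeta_comul h x.
Proof.
rewrite /zeta_term insubT /=; exact: zeta_comul_irr.
Qed.

Lemma zeta_term_filter I (x : H (fin I)) s :
  zeta_term x (filter (predC1 set0) s) = zeta_term x s.
Proof.
have [h|nh] := boolP (decomposition I s).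
  have h' : decomposition I (filter (predC1 set0) s) by rewrite decomposition_filter.
  by rewrite !zeta_termE; apply/esym; apply: zeta_comul_filter.
by rewrite /zeta_term !insubN ?decomposition_filter.
Qed.

Lemma zeta_term_large I (x : H (fin I)) s :
  set0 \notin s -> (#|I| < size s)%N -> zeta_term x s = 0.
Proof.
move=> n0 lt_I; rewrite /zeta_term insubN //; apply: contraL lt_I => h.
by rewrite -leqNgt composition_size // /composition h.
Qed.

Lemma sum_zeta_comul I (x : H (fin I)) n (P : pred (seq {set U}))
    (hP : forall s, P s -> decomposition I s) :
  \sum_(s : {s : n.-tuple {set U} | P s}) zeta_comul (hP _ (valP s)) x =
  \sum_(s : n.-tuple {set U} | P s) zeta_term x s.
Proof.
under eq_bigr do rewrite -zeta_termE.
by rewrite (big_sub (fun s : n.-tuple {set U} => P s)).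
Qed.

Lemma zeta_term_out I (x : H (fin I)) s : ~~ decomposition I s -> zeta_term x s = 0.
Proof. by move=> nd; rewrite /zeta_term insubN. Qed.

Lemma chi_decompE I (x : H (fin I)) n :
  chi zeta x n = \sum_(s : n.-tuple {set U} | decomposition I s) zeta_term x s.
Proof. by rewrite -(sum_zeta_comul x n (fun s (h : decomposition I s) => h)). Qed.

Lemma chiE I (x : H (fin I)) n :
  chi zeta x n = \sum_(s : n.-tuple {set U}) zeta_term x s.
Proof.
rewrite chi_decompE [RHS](bigID (fun s : n.-tuple _ => decomposition I s)) /=.
by rewrite [X in _ + X]big1 ?addr0 // => s; apply: zeta_term_out.
Qed.

Lemma chi_coefE I (x : H (fin I)) j :
  chi_coef zeta x j =
  \sum_(s : j.-tuple {set U} | set0 \notin (s : seq _)) zeta_term x s.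
Proof.
rewrite [RHS](bigID (fun s : j.-tuple _ => decomposition I s)) /=.
rewrite [X in _ + X]big1 ?addr0; last by move=> s /andP[_]; apply: zeta_term_out.
rewrite [LHS](sum_zeta_comul x j (@composition_decomposition _ I)) //.
by apply: eq_bigl => s; rewrite andbC.
Qed.

(** The sum over j is first taken up to a bound above both n and |I|; its terms
    with j > |I| vanish because no composition of I has that many parts. *)
Lemma chi_binomial I (x : H (fin I)) n :
  chi zeta x n = \sum_(j < #|I|.+1) chi_coef zeta x j * 'C(n, j)%:R.
Proof.
rewrite chiE.
under eq_bigr do rewrite -zeta_term_filter.
rewrite (sum_tuple_filter set0 (zeta_term x) (m := maxn n.+1 #|I|.+1)) ?leq_maxl //.
rewrite (big_ord_widen _ (fun j => chi_coef zeta x j * 'C(n, j)%:R)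
           (leq_maxr n.+1 #|I|.+1)).
rewrite [RHS]big_mkcond; apply: eq_bigr => j _; rewrite chi_coefE ltnS.
case: leqP => // lt_Ij; rewrite big1 ?mul0r // => s n0.
by rewrite zeta_term_large ?size_tuple.
Qed.

End Fixed.

(** [h] ranges over all functions with images as prescribed, rather than being
    the image map of [f]: in the induction [f] is replaced by its restriction
    to the union of the remaining parts, while [h] has to stay the same. *)
Lemma zeta_comul_natural (U V : finType) (I : {set U}) (J : {set V})
    (f : fin I -> fin J) (hf : bijective f) (h : {set U} -> {set V})
    (s : seq {set U}) (d : decomposition I s) (d' : decomposition J (map h s)) x :
  {in s, forall A, transports f A (h A)} ->
  zeta_comul d' (sp_map H hf x) = zeta_comul d x.
Proof.
elim: s I J f hf d d' x => [|A s IH] I J f hf d d' x tr.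
  have eI := decomposition_nil d; have eJ := decomposition_nil d'.
  (* The counit is natural because its inverse, the unit, is. *)
  subst I J; rewrite !zeta_comul_nil -{1}(hm_counitK x).
  by rewrite hm_unit_natural hm_unitK.
have hd := decomposition_head d; have ht := decomposition_tail d.
have hd' := decomposition_head d'; have ht' := decomposition_tail d'.
have /andP[sA sB] := disj_union_sub hd.
have /andP[sA' sB'] := disj_union_sub hd'.
have trs : {in s, forall C, transports f C (h C)}.
  by move=> C Cs; apply: tr; rewrite in_cons Cs orbT.
have [gA bA rA] := restriction_bij hf sA sA' (tr A (mem_head _ _)).
have [gB bB rB] := restriction_bij hf sB sB' (transports_bigcup trs).
rewrite (zeta_comul_cons d hd ht) (zeta_comul_cons d' hd' ht').
rewrite (hm_comul_natural hd hd' hf bA bB rA rB) tprod_tmap.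
apply: eq_tprod => y /=; first exact: chr_natural.
apply: IH => C Cs b.
pose i : fin I := Sub (val b) (subsetP sB _ (valP b)).
by rewrite -(rB i) // -trs.
Qed.

(** Image and preimage maps are inverse to each other on decompositions, so they
    reindex one sum into the other. *)
Lemma chi_natural (U V : finType) (I : {set U}) (J : {set V})
    (f : fin I -> fin J) (hf : bijective f) (x : H (fin I)) n :
  chi zeta x n = chi zeta (sp_map H hf x) n.
Proof.
have [f' fK f'K] := hf; have hf' : bijective f' by exists f.
rewrite !chi_decompE.
rewrite [RHS](reindex_onto (map_tuple (push f)) (map_tuple (push f'))) /=.
  have mapK (s : seq {set U}) : decomposition I s ->
      map (push f') (map (push f) s) = s.
    move=> d; rewrite -map_comp -[RHS]map_id; apply/eq_in_map => A As /=.
    by rewrite (pushK fK) // (decomposition_sub d).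
  apply: eq_big => [s|s d]; last first.
    have d' := decomposition_push hf d.
    rewrite !zeta_termE; apply/esym/zeta_comul_natural => A _.
    exact: transports_push (can_inj fK).
  apply/idP/andP => [d|[d /eqP <-]].
    split; first exact: decomposition_push.
    by apply/eqP/val_inj; apply: mapK.
  exact: (decomposition_push hf').
move=> t d; apply: val_inj; rewrite /= -map_comp -[RHS]map_id.
by apply/eq_in_map => A At /=; rewrite (pushK f'K) // (decomposition_sub d).
Qed.

End Evaluation.

Unset Implicit Arguments.

Theorem proposition16p1 (k : fieldType) (hk : [pchar k] =i pred0)
    (H : hopf_monoid k) (zeta : character H)
    (U : finType) (I : {set U}) (x : H (fin I)) :
  [/\ forall n : nat,
        chi zeta x n = \sum_(j < #|I|.+1) chi_coef zeta x j * 'C(n, j)%:R,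
      exists p : {poly k}, (size p <= #|I|.+1)%N /\
        (forall n : nat, chi zeta x n = p.[n%:R])
    & forall (V : finType) (J : {set V}) (s : fin I -> fin J)
        (hs : bijective s) (n : nat),
        chi zeta x n = chi zeta (sp_map H hs x) n].
Proof.
split=> [n||V J s hs n]; [exact: chi_binomial | | exact: chi_natural].
exists (\sum_(j < #|I|.+1) chi_coef zeta x j *: binom_poly k j); split=> [|n].
  apply: leq_trans (size_sum _ _ _) _; apply/bigmax_leqP => j _.
  by rewrite (leq_trans (size_scale_leq _ _)) // (leq_trans (size_binom_poly k j)).
rewrite chi_binomial horner_sum; apply: eq_bigr => j _.
by rewrite hornerZ horner_binom_poly.
Qed.
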